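(* Let $G$ be a Polish group, $X$ a separable metrizable space and $f:G\to X$ a function with the Baire property. Let $T\subset G$ be a set of second category and let $g:G^2\to X$ be a function such that for each $t\in T$ the function $g(\cdot,t)$ is equal to $f(\cdot+t)$ on a residual subset of $G$. If there exists a second countable topology $\mathcal{T}$ on the set $T$ such that for a residual set of $s\in G$ the function $g(s,\cdot)|_T$ is $\mathcal{T}$-continuous, then $f$ is equal on a residual set to a continuous function $h:G\to X$, and for a residual set of $s\in G$, $g(s,\cdot)|_T=h(s+\cdot)|_T$.
   Context: The group $G$ is not assumed Abelian, but its operation is written additively. A set is of first category if it is a countable union of nowhere dense sets, and of second category otherwise; a subset of $G$ is residual if its complement is of first category. A function has the Baire property if preimages of open sets have the Baire property. The topology $\mathcal{T}$ is not assumed related to the topology of $G$; continuity of $h$ is with respect to the given topology of $G$. *)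

(* Defs.v *)
From HB Require Import structures.
From mathcomp Require Import all_boot all_order all_algebra.
From mathcomp Require Import all_classical all_reals topology.

Set Implicit Arguments.
Unset Strict Implicit.
Unset Printing Implicit Defensive.

Import Order.TTheory GRing.Theory Num.Theory.
Local Open Scope classical_set_scope.
Local Open Scope ring_scope.

(* Not necessarily abelian topological groups: MathComp reserves additive
   notation for commutative operations, so the group law is written [x * y] in
   [group_scope]. *)
HB.mixin Record isTopologicalGroup G & Topological G & Group G := {
  mulg_continuous : continuous (fun x : G * G => (x.1 * x.2)%g) ;
  invg_continuous : continuous (fun x : G => (x^-1)%g)
}.

#[short(type="topologicalGroupType")]
HB.structure Definition TopologicalGroup :=
  {G of Topological G & Group G & isTopologicalGroup G}.

(* [realType] is unique up to isomorphism, so metrizability does not depend on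
   the copy [R] of the real numbers in which metrics take their values. *)
Section Metrizability.
Context (R : realType).

Definition is_metric (T : Type) (d : T -> T -> R) : Prop :=
  [/\ forall x y, d x y = 0 <-> x = y,
      forall x y, d x y = d y x &
      forall x y z, d x z <= d x y + d y z].

Definition induces_topology (T : topologicalType) (d : T -> T -> R) : Prop :=
  forall x, nbhs x = nbhs_ball_ (fun y e => [set z | d y z < e]) x.

Definition metrizable (T : topologicalType) : Prop :=
  exists2 d : T -> T -> R, is_metric d & induces_topology d.

Definition complete_metric (T : topologicalType) (d : T -> T -> R) : Prop :=
  forall u : nat -> T,
    (forall e : R, 0 < e -> exists N, forall m n,
      (N <= m)%N -> (N <= n)%N -> d (u m) (u n) < e) ->
    exists l : T, u @ \oo --> l.

Definition completely_metrizable (T : topologicalType) : Prop :=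
  exists d : T -> T -> R,
    [/\ is_metric d, induces_topology d & complete_metric d].

End Metrizability.

Definition separable (T : topologicalType) : Prop :=
  exists2 D : set T, countable D & dense D.

Definition polish (R : realType) (T : topologicalType) : Prop :=
  separable T /\ completely_metrizable R T.

Section Category.
Context {T : topologicalType}.
Implicit Types A : set T.

Definition nowhere_dense A : Prop := (closure A)° = set0.

Definition first_category A : Prop :=
  exists2 F : nat -> set T,
    (forall n, nowhere_dense (F n)) & A = \bigcup_n F n.

Definition second_category A : Prop := ~ first_category A.

Definition residual A : Prop := first_category (~` A).

Definition baire_property A : Prop :=
  exists2 U : set T, open U & first_category (A `+` U).

End Category.

Definition baire_function (S T : topologicalType) (f : S -> T) : Prop :=
  forall U : set T, open U -> baire_property (f @^-1` U).

(* Main.v *)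
(* On a residual set E the restriction of f is continuous, so it suffices to
   show that f|E has a limit at every point x of G. Let D be a countable subset
   of T, dense for the join of the topology of G and tau. For s in a residual
   set S, g(s, _) is tau-continuous and, for all d in D, s d is in E and
   g(s, d) = f(s d). For t outside a meager subset of T, every basic tau-open
   set containing t is dense in a G-neighbourhood of t. As T is of second
   category, some such t satisfies x t^-1 \in S. With s = x t^-1, near x the
   values of f|E are limits of values f(s d) = g(s, d) with d tau-close to t,
   hence f|E tends to g(s, t) at x. *)
Require Import Defs.
From mathcomp Require Import all_boot all_order all_algebra.
From mathcomp Require Import all_classical all_reals topology.
Local Open Scope classical_set_scope.

Set Implicit Arguments.
Unset Strict Implicit.
Unset Printing Implicit Defensive.

(** * Calculus of first category and residual sets *)

Section Category.
Context {T : topologicalType}.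
Implicit Types A B : set T.

Lemma nowhere_denseS A B : A `<=` B -> nowhere_dense B -> nowhere_dense A.
Proof.
move=> AB nB; apply/seteqP; split => // x.
by move=> /(interiorS (closureS AB)); rewrite [X in X x -> _]nB.
Qed.

Lemma nowhere_dense0 : nowhere_dense (set0 : set T).
Proof. by rewrite /nowhere_dense closure0 interior0. Qed.

Lemma first_categoryS A B : A `<=` B -> first_category B -> first_category A.
Proof.
move=> AB [F nF BE]; exists (fun n => A `&` F n).
  by move=> n; apply: nowhere_denseS (nF n); exact: subIsetr.
by rewrite -setI_bigcupr -BE; apply/esym/setIidPl.
Qed.

Lemma nowhere_dense_first_category A : nowhere_dense A -> first_category A.
Proof.
by move=> nA; exists (fun=> A) => //; rewrite bigcup_const//; exists 0%N.
Qed.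

Lemma first_category_bigcup (I : Type) (D : set I) (F : I -> set T) :
  countable D -> (forall i, D i -> first_category (F i)) ->
  first_category (\bigcup_(i in D) F i).
Proof.
move=> /countable_injP[c cinj] fcF.
have /choice[H HF] : forall i, exists H : nat -> set T,
    D i -> (forall n, nowhere_dense (H n)) /\ F i = \bigcup_n H n.
  move=> i; have [Di|nDi] := pselect (D i); last by exists (fun=> set0).
  by have [H nH FE] := fcF i Di; exists H.
(* Slot [n] holds the piece [H i k] when [n] encodes [(c i, k)]. Injectivity of [c] on [D] leaves at
   most one piece per slot; slots that encode nothing are empty. *)
exists (fun n => [set x | exists i k,
    [/\ D i, n = pickle (c i, k) & H i k x]]).
  move=> n.
  have [[i [k [Di nE]]]|none] :=
    pselect (exists i (k : nat), D i /\ n = pickle (c i, k)); last first.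
    apply: nowhere_denseS nowhere_dense0 => x [i [k [Di nE _]]].
    by apply: none; exists i, k.
  apply: nowhere_denseS ((HF i Di).1 k) => x [j [l [Dj +]]].
  rewrite nE => /(pcan_inj pickleK)[cij <-].
  by rewrite (cinj i j)//; apply/mem_set.
apply/seteqP; split => x.
  move=> [i Di]; rewrite (HF i Di).2 => -[k _ Hx].
  by exists (pickle (c i, k)) => //; exists i, k.
by move=> [n _ [i [k [Di _ Hx]]]]; exists i => //; rewrite (HF i Di).2; exists k.
Qed.

Lemma residual_bigcap (I : Type) (D : set I) (F : I -> set T) :
  countable D -> (forall i, D i -> residual (F i)) ->
  residual (\bigcap_(i in D) F i).
Proof. by move=> cD rF; rewrite /residual setC_bigcap; exact: first_category_bigcup. Qed.

Lemma residualS A B : A `<=` B -> residual A -> residual B.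
Proof. by move=> /subsetC; exact: first_categoryS. Qed.

Lemma residualI A B : residual A -> residual B -> residual (A `&` B).
Proof.
move=> rA rB.
have : residual (\bigcap_(b in [set: bool]) if b then A else B).
  by apply: residual_bigcap => // -[].
by apply: residualS => x AB; split; [exact: (AB true)|exact: (AB false)].
Qed.

Lemma second_category_residual_meets A B :
  second_category A -> residual B -> A `&` B !=set0.
Proof.
move=> sA rB; apply: contrapT => /set0P/negP/negPn/eqP AB; apply: sA.
by apply: first_categoryS rB; apply/disjoints_subset.
Qed.

(** The closure of the difference stays in the closed set [closure A] minus its interior, so an
    interior point of it would lie both inside and outside [(closure A)°]. Hence, off a nowhere
    dense subset, each point of [A] has a neighbourhood in which [A] is dense. *)
Lemma nowhere_dense_boundary A : nowhere_dense (A `\` (closure A)°).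
Proof.
have sub : closure (A `\` (closure A)°) `<=` closure A `&` ~` (closure A)°.
  have /closure_id-> : closed (closure A `&` ~` (closure A)°).
    by apply: closedI; [exact: closed_closure|exact/open_closedC/open_interior].
  by apply: closureS => x [Ax nx]; split => //; exact: subset_closure.
apply/seteqP; split => // x wx.
have [_ +] := sub _ (interior_subset wx); apply.
by apply: interiorS wx => y /sub[].
Qed.

End Category.

(** * Invariance of category under homeomorphisms *)

Section Homeomorphism.
Context {S T : topologicalType} (u : S -> T) (v : T -> S).
Hypotheses (uv : cancel u v) (vu : cancel v u).
Hypotheses (cu : continuous u) (cv : continuous v).

Lemma nowhere_dense_preimage (A : set T) :
  nowhere_dense A -> nowhere_dense (u @^-1` A).
Proof.
move=> nA; apply/seteqP; split => // x wx.
suff : (closure A)° (u x) by rewrite [X in X _ -> _]nA.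
have : nbhs (u x) (v @^-1` closure (u @^-1` A)) by apply: cv; rewrite uv.
apply: filterS => z clz B; rewrite -{1}(vu z) => /cu/clz[w [Aw Bw]].
by exists (u w).
Qed.

Lemma first_category_preimage (A : set T) :
  first_category A -> first_category (u @^-1` A).
Proof.
move=> [F nF ->]; exists (fun n => u @^-1` F n).
  by move=> n; exact: nowhere_dense_preimage.
by rewrite preimage_bigcup.
Qed.

Lemma residual_preimage (A : set T) : residual A -> residual (u @^-1` A).
Proof. exact: first_category_preimage. Qed.

End Homeomorphism.

(** * Separation and countability in metrizable spaces *)

Section Metrizable.
Context {R : realType} {X : topologicalType}.
Import Order.TTheory GRing.Theory Num.Theory.
Local Open Scope ring_scope.

Section Distance.
Variable d : X -> X -> R.
Hypotheses (dm : is_metric d) (dX : induces_topology d).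

Lemma nbhs_metricP x (A : set X) :
  nbhs x A <-> exists2 e : R, 0 < e & [set z | d x z < e] `<=` A.
Proof. by rewrite dX. Qed.

Lemma nbhs_metric_ball x (e : R) : 0 < e -> nbhs x [set z | d x z < e].
Proof. by move=> e0; apply/nbhs_metricP; exists e. Qed.

Lemma open_metric_ball x (e : R) : open [set z | d x z < e].
Proof.
have [_ _ tri] := dm; rewrite openE => y /= xy; apply/nbhs_metricP.
exists (e - d x y) => [|z /=]; first by rewrite subr_gt0.
by rewrite ltrBrDl; exact: le_lt_trans.
Qed.

End Distance.

Lemma metrizable_regular : metrizable R X -> regular_space X.
Proof.
move=> [d dm dX] x A /(nbhs_metricP dX)[e e0 eA].
have [_ dC tri] := dm.
exists [set z | d x z < e / 2].
  by apply: nbhs_metric_ball => //; rewrite divr_gt0.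
move=> z clz; apply: eA => /=.
have [|w /= [xw zw]] := clz [set w | d z w < e / 2].
  by apply: nbhs_metric_ball => //; rewrite divr_gt0.
by rewrite (le_lt_trans (tri x w z))// (splitr e) ltrD// dC.
Qed.

Lemma metrizable_hausdorff : metrizable R X -> hausdorff_space X.
Proof.
move=> [d dm dX] x y xy; have [d0 dC tri] := dm.
have dge0 : 0 <= d x y.
  have := tri x y x; rewrite (dC y x) (d0 x x).2// -mulr2n pmulrn_lge0//.
apply/d0/eqP; rewrite eq_le dge0 andbT leNgt; apply/negP => dxy.
have e0 : 0 < d x y / 2 by rewrite divr_gt0.
have [z /= [xz yz]] :=
  xy _ _ (nbhs_metric_ball dX x e0) (nbhs_metric_ball dX y e0).
suff : d x y < d x y by rewrite ltxx.
by rewrite [ltRHS]splitr (le_lt_trans (tri x z y))// ltrD// dC.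
Qed.

Lemma metrizable_second_countable :
  separable X -> metrizable R X -> @second_countable X.
Proof.
move=> [D cD dD] [d dm dX]; have [_ dC tri] := dm.
pose B (p : X * nat) := [set z | d p.1 z < p.2.+1%:R^-1].
exists (B @` (D `*` setT)).
  exact: (sub_countable (card_image_le _ _) (countableX cD (countableP _))).
split=> [_ [p _ <-]|x A /(nbhs_metricP dX)[e e0 eA]].
  exact: open_metric_ball.
have [k ke] : exists k : nat, k.+1%:R^-1 < e / 2.
  have [|k] := @ltr_add_invr R 0 (e / 2); first by rewrite divr_gt0.
  by rewrite add0r => ke; exists k.
have k0 : 0 < k.+1%:R^-1 :> R by rewrite invr_gt0.
have [|c [xc Dc]] := dD _ _ (open_metric_ball dm dX x k.+1%:R^-1).
  by exists x; apply: nbhs_singleton; exact: nbhs_metric_ball.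
exists (B (c, k)); first by split; [exists (c, k)|rewrite /B/= dC].
move=> z /= cz; apply: eA => /=.
by rewrite (le_lt_trans (tri x c z))// (splitr e) ltrD//; exact: lt_trans ke.
Qed.

End Metrizable.

(** * Restricting to a residual set and extending from a dense one *)

Lemma baire_function_continuous_residual (S X : topologicalType) (f : S -> X) :
  @second_countable X -> baire_function f ->
  exists2 E : set S, residual E &
    forall x, E x -> f @ within E (nbhs x) --> f x.
Proof.
move=> [B cB [oB bB]] bf.
have /choice[U BU] : forall V, exists U : set S,
    B V -> open U /\ first_category ((f @^-1` V) `+` U).
  move=> V; have [BV|nBV] := pselect (B V); last by exists set0.
  by have [U oU fU] := bf V (oB V BV); exists U.
(* On this set, [f z] lies in a basic [V] exactly when [z] lies in the open set [U V]; only
   countably many meager sets are removed. *)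
exists (\bigcap_(V in B) ~` ((f @^-1` V) `+` U V)).
  by apply: residual_bigcap => // V /BU[_]; rewrite /residual setCK.
move=> x Ex W /bB[V [BV Vx] VW].
have agree z : (~` ((f @^-1` V) `+` U V)) z -> (V (f z) <-> U V z).
  by move=> nz; split=> h; apply: contrapT => h'; apply: nz; [left|right].
have Ux : U V x by apply/agree => //; exact: Ex.
have : nbhs x (U V) by apply: open_nbhs_nbhs; split=> //; exact: (BU V BV).1.
apply: filterS => z Uz Ez; apply: VW; apply/agree => //; exact: Ez.
Qed.

(** Near [x] the values of [f] on [E] lie in [W], so those of [h], being limits of them, lie only in
    [closure W]; regularity puts this closure inside the target neighbourhood. *)
Lemma continuous_extension_dense (S X : topologicalType) (f : S -> X)
    (E : set S) (h : S -> X) :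
  regular_space X -> dense E ->
  (forall x, f @ within E (nbhs x) --> h x) -> continuous h.
Proof.
move=> rX dE fh x V /rX[W Wx WV].
have := fh x W Wx; rewrite /= /fmap /= /within /= => /nbhs_interior.
apply: filterS => y fW; apply: WV => Z Zy.
have [z [[/interior_subset Wz Zz] Ez]] :
    ([set z | E z -> W (f z)]° `&` [set z | E z -> Z (f z)]°) `&` E !=set0.
  apply: dE; last by apply: openI; exact: open_interior.
  by exists y; split=> //; exact: fh.
by exists (f z); split; [exact: Wz|exact: (interior_subset Zz)].
Qed.

(** * Translations and inversion as homeomorphisms *)

Section TopologicalGroup.
Context {G : topologicalGroupType}.
Implicit Types (a : G) (A : set G).
Local Open Scope group_scope.

Lemma continuous_mulgr a : continuous (fun x : G => x * a).
Proof.
move=> x; apply: (@continuous_comp _ _ _ (fun x : G => (x, a)) (fun p => p.1 * p.2)).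
  by apply: cvg_pair; [exact: cvg_id|exact: cvg_cst].
exact: mulg_continuous.
Qed.

Lemma continuous_mulgl a : continuous (fun x : G => a * x).
Proof.
move=> x; apply: (@continuous_comp _ _ _ (fun x : G => (a, x)) (fun p => p.1 * p.2)).
  by apply: cvg_pair; [exact: cvg_cst|exact: cvg_id].
exact: mulg_continuous.
Qed.

Lemma continuous_divgl a : continuous (fun x : G => a * x^-1).
Proof.
move=> x; apply: (@continuous_comp _ _ _ (fun x : G => x^-1) (fun x => a * x)).
  exact: invg_continuous.
exact: continuous_mulgl.
Qed.

Lemma continuous_divgr a : continuous (fun x : G => x^-1 * a).
Proof.
move=> x; apply: (@continuous_comp _ _ _ (fun x : G => x^-1) (fun x => x * a)).
  exact: invg_continuous.
exact: continuous_mulgr.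
Qed.

Lemma residual_mulgr a A : residual A -> residual [set s | A (s * a)].
Proof.
apply: (@residual_preimage _ _ (fun s => s * a) (fun s => s * a^-1)).
- exact: mulgK.
- exact: mulgVK.
- exact: continuous_mulgr.
- exact: continuous_mulgr.
Qed.

Lemma residual_divgl a A : residual A -> residual [set t | A (a * t^-1)].
Proof.
apply: (@residual_preimage _ _ (fun t => a * t^-1) (fun s => s^-1 * a)).
- by move=> t; rewrite invgM invgK mulgVK.
- by move=> s; rewrite invgM invgK mulgA mulgV mul1g.
- exact: continuous_divgl.
- exact: continuous_divgr.
Qed.

(* Countably many translates of a nonempty open set cover a separable group,
   so a meager one would make the whole group, hence T, meager. *)
Lemma residual_dense (T : set G) A :
  separable G -> second_category T -> residual A -> dense A.
Proof.
move=> [D cD dD] sT rA O [o Oo] oO; apply: contrapT => OA.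
have fcO : first_category O.
  by apply: first_categoryS rA => x Ox Ax; apply: OA; exists x.
apply: sT.
apply: (@first_categoryS _ _ (\bigcup_(c in D) [set s | O (c^-1 * s)])).
  move=> s _; have [||c [Oc Dc]] := dD [set c | O (c^-1 * s)].
  - by exists (s * o^-1); rewrite /= invgM invgK mulgVK.
  - move/continuousP: (@continuous_divgr s); exact.
  - by exists c.
apply: first_category_bigcup => // c _.
apply: (@first_category_preimage _ _ (fun s => c^-1 * s) (fun s => c * s)) => //.
- exact: mulVKg.
- exact: mulKg.
- exact: continuous_mulgl.
- exact: continuous_mulgl.
Qed.

End TopologicalGroup.

(** One point is chosen in each nonempty set of points sent into [U] by [p] and into [V] by [q],
    with [U] and [V] basic. With [p] the inclusion of [T] in [G] and [q] the identity, this gives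
    density for the join of two topologies. *)
Lemma countable_jointly_dense (A : Type) (S S' : topologicalType)
    (p : A -> S) (q : A -> S') :
  @second_countable S -> @second_countable S' ->
  exists2 D : set A, countable D &
    forall a U V, nbhs (p a) U -> nbhs (q a) V ->
      exists d, [/\ D d, U (p d) & V (q d)].
Proof.
move=> [B cB [_ bB]] [C cC [_ bC]].
have [[a0]|A0] := pselect (inhabited A); last first.
  by exists set0 => // a; exfalso; apply: A0.
have /choice[c cP] : forall UV : set S * set S', exists d : A,
    forall a, UV.1 (p a) -> UV.2 (q a) -> UV.1 (p d) /\ UV.2 (q d).
  move=> [U V]; have [[d [Ud Vd]]|none] := pselect (exists d, U (p d) /\ V (q d)).
    by exists d.
  by exists a0 => a Ua Va; exfalso; apply: none; exists a.
exists (c @` (B `*` C)).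
  exact: (sub_countable (card_image_le _ _) (countableX cB cC)).
move=> a U V /bB[U' [BU' U'a] U'U] /bC[V' [CV' V'a] V'V].
have [U'c V'c] := cP (U', V') a U'a V'a.
by exists (c (U', V')); split; [exists (U', V')|exact: U'U|exact: V'V].
Qed.

(** * The limit of [f] along [E], and its identification with [g] *)

Theorem theorem12 (R : realType) (G : topologicalGroupType)
    (X : topologicalType) (f : G -> X) (T : set G) (g : G * G -> X) :
  polish R G ->
  separable X -> metrizable R X ->
  baire_function f ->
  second_category T ->
  (forall t, T t -> residual [set s : G | g (s, t) = f (s * t)%g]) ->
  (exists2 tau : Topological T, @second_countable (Topological.Pack tau) &
     residual [set s : G |
       continuous ((fun t : T => g (s, \val t)) : Topological.Pack tau -> X)]) ->
  exists h : G -> X,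
    [/\ continuous h,
        residual [set x : G | f x = h x] &
        residual [set s : G |
          forall t, T t -> g (s, t) = h (s * t)%g]].
Proof.
move=> [sG [dG [dGm dGi _]]] sX mX bf sT gf [tau tau2].
set T' := Topological.Pack tau => gcont.
have rX := metrizable_regular mX; have hX := metrizable_hausdorff mX.
have G2 : @second_countable G.
  by apply: (metrizable_second_countable sG); exists dG.
have [E rE fE] :=
  baire_function_continuous_residual (metrizable_second_countable sX mX) bf.
have dE := residual_dense sG sT rE.
have [D cD Ddense] :=
  countable_jointly_dense (fun t : T => \val t) (id : T -> T') G2 tau2.
pose S := [set s : G | continuous ((fun t : T => g (s, \val t)) : T' -> X)] `&`
  \bigcap_(d in D) ([set s | g (s, \val d) = f (s * \val d)%g] `&`
                    [set s | E (s * \val d)%g]).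
have rS : residual S.
  apply: residualI => //; apply: residual_bigcap => // d _.
  apply: residualI; last exact: residual_mulgr.
  by apply: gf; exact: set_valP.
have f_lim : forall x : G, exists y : X, f @ within E (nbhs x) --> y.
  move=> x; have [C cC [oC bC]] := tau2.
  (* A point of [good] lying in a basic [V] has a neighbourhood in [G] where [V] is dense. *)
  pose good : set G := \bigcap_(V in C)
    ~` (((fun t : T => \val t) @` V) `\` (closure ((fun t : T => \val t) @` V))°).
  have rgood : residual good.
    apply: residual_bigcap => // V _; rewrite /residual setCK.
    exact/nowhere_dense_first_category/nowhere_dense_boundary.
  have [t0 [Tt0 [good0 [cont0 D0]]]] := second_category_residual_meets sT
    (residualI rgood (residual_divgl x rS)).
  set s0 := (x * t0^-1)%g in cont0 D0.
  pose t : T := exist _ t0 (mem_set Tt0).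
  exists (g (s0, t0)) => V /rX[W W0 WV].
  have [V' [CV' V't] V'W] := bC (t : T') _ (cont0 t W W0).
  have int0 : (closure ((fun t : T => \val t) @` V'))° t0.
    by apply: contrapT => n; apply: (good0 V' CV'); split => //; exists t.
  (* Since [s0 * t0 = x], left translation by [s0] carries the neighbourhood of [t0] where [V'] is
     dense to a neighbourhood of [x]. *)
  have : nbhs x ((fun u => (s0^-1 * u)%g) @^-1`
      closure ((fun t : T => \val t) @` V')).
    by apply: continuous_mulgl; rewrite /s0 invgM invgK mulgVK.
  (* It suffices that [f u] lies in [closure W]. Some [r] in [V'] has [s0 * r] so near [u] that [f]
     sends the points of [E] around [s0 * r] into [Z]. A point [d] of [D] close to [r] in both
     topologies then gives [f (s0 * d) = g (s0, d)] in both [Z] and [W]. *)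
  apply: filterS => u clu Eu; apply: WV => Z /(fE u Eu).
  rewrite /= /within /= => /nbhs_interior; rewrite -{1}(mulVKg s0 u).
  move=> /continuous_mulgl/clu[_ [[r V'r <-] /= intr]].
  have [d [Dd /= Zd V'd]] := Ddense r
    ((fun v => (s0 * v)%g) @^-1` [set v | E v -> Z (f v)]) V'
    (continuous_mulgl intr) (open_nbhs_nbhs (conj (oC _ CV') V'r)).
  have [gd Ed] := D0 d Dd.
  exists (f (s0 * \val d)%g); split; last exact: Zd.
  by rewrite -gd; exact: V'W.
have [h fh] := choice f_lim.
(* At a point of [E] both [f x] and [h x] are limits of [f] along [E]. *)
have fhE x : E x -> f x = h x.
  move=> Ex; apply: hX => A B fA hB; exists (f x).
  by split; [exact: nbhs_singleton|exact: (nbhs_singleton (fh x B hB))].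
have ch : continuous h := continuous_extension_dense rX dE fh.
exists h; split => //; first exact: residualS rE.
apply: residualS rS => s [conts Ds] t0 Tt0.
pose t : T := exist _ t0 (mem_set Tt0).
(* Both sides are limits of the common values [g (s, d) = f (s * d) = h (s * d)] as [d] in [D]
   approaches [t] in both topologies: [tau] serves [g], that of [G] serves [h]. *)
apply: hX => A B gA hB.
have [d [Dd /= Bd Ad]] := Ddense t _ _
  (continuous_mulgl (ch _ B hB)) (conts t A gA).
have [gd Ed] := Ds d Dd.
by exists (g (s, \val d)); split => //; rewrite gd fhE.
Qed.
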